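(* Let $V$ be an $m\times n$ $(0,1)$-matrix and $B$ a $p\times q$ $(0,1)$-matrix, let $L=\begin{bmatrix}0 & V\\ V^T & 0\end{bmatrix}$, $H=\begin{bmatrix}0 & B\\ B^T & 0\end{bmatrix}$, $H^{\#}=\begin{bmatrix}0 & B^T\\ B & 0\end{bmatrix}$, and suppose the bipartite graphs $G_L$ and $G_H$ (not necessarily connected) have no isolated vertices. Then the following are equivalent: (a) there exists an isomorphism between $G_{L\underline{\otimes}H}$ and $G_{L\underline{\otimes}H^{\#}}$ which respects the partite sets of the canonical bipartitions; (b) at least one of $G_L$ (with respect to $V$) or $G_H$ (with respect to $B$) has property $\pi$, i.e. $V$ is PET or $B$ is PET.
   Context: For a symmetric $(0,1)$-matrix $A$ with zero diagonal, $G_A$ is the simple graph with adjacency matrix $A$; so $G_L$ (resp. $G_H$) is the bipartite graph with biadjacency matrix $V$ (resp. $B$). The partitioned tensor product of $2\times 2$ block matrices is $\begin{bmatrix}U & V'\\ W & X\end{bmatrix}\underline{\otimes}\begin{bmatrix}A & B'\\ C & D\end{bmatrix}=\begin{bmatrix}U\otimes A & V'\otimes B'\\ W\otimes C & X\otimes D\end{bmatrix}$ ($\otimes$ the Kronecker product), so $L\underline{\otimes}H=\begin{bmatrix}0 & V\otimes B\\ V^T\otimes B^T & 0\end{bmatrix}$ and $L\underline{\otimes}H^{\#}=\begin{bmatrix}0 & V\otimes B^T\\ V^T\otimes B & 0\end{bmatrix}$. The canonical bipartition of $G_{L\underline{\otimes}H}$ is $X_1\cup Y_1$, where $X_1$ is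 the set of the first $mp$ vertices (rows of $V\otimes B$) and $Y_1$ the last $nq$ vertices (columns of $V\otimes B$); the canonical bipartition of $G_{L\underline{\otimes}H^{\#}}$ is $X_2\cup Y_2$ with $X_2$ the first $mq$ vertices (rows of $V\otimes B^T$) and $Y_2$ the last $np$ vertices. An isomorphism $f$ respects these partite sets if either $f(X_1)=X_2$ and $f(Y_1)=Y_2$, or $f(X_1)=Y_2$ and $f(Y_1)=X_2$. A square matrix $M$ is PET if it is permutationally equivalent to its transpose, i.e. $PMQ=M^T$ for some permutation matrices $P,Q$. A bipartite graph with biadjacency matrix $M$ has property $\pi$ with respect to $M$ if $M$ is PET. *)

(* Defs.v *)
From mathcomp Require Import all_boot all_order all_algebra.
From mathcomp.real_closed Require Export mxtens.

Set Implicit Arguments.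
Unset Strict Implicit.
Unset Printing Implicit Defensive.

Import GRing.Theory.
Local Open Scope ring_scope.

Definition zero_one (m n : nat) (A : 'M[int]_(m, n)) : Prop :=
  forall i j, A i j = 0 \/ A i j = 1.

(* The edge relation of G_A on 'I_N; symmetric and irreflexive when A is       *)
(* symmetric with zero diagonal (adjacency_sym and adjacency_irr below).       *)
Definition adjacency (N : nat) (A : 'M[int]_N) : rel 'I_N :=
  fun x y => A x y == 1.

Definition no_isolated (N : nat) (A : 'M[int]_N) : Prop :=
  forall x, exists y, adjacency A x y.

Definition bip_mx (m n : nat) (M : 'M[int]_(m, n)) : 'M[int]_(m + n) :=
  block_mx 0 M M^T 0.

Definition bip_sharp_mx (m n : nat) (M : 'M[int]_(m, n)) : 'M[int]_(n + m) :=
  block_mx 0 M^T M 0.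

(* The block sizes are read off the types; *t is the Kronecker product.        *)
Definition ptensmx (m1 m2 n1 n2 p1 p2 q1 q2 : nat)
    (M : 'M[int]_(m1 + m2, n1 + n2)) (N : 'M[int]_(p1 + p2, q1 + q2)) :
    'M[int]_(m1 * p1 + m2 * p2, n1 * q1 + n2 * q2) :=
  block_mx (ulsubmx M *t ulsubmx N) (ursubmx M *t ursubmx N)
           (dlsubmx M *t dlsubmx N) (drsubmx M *t drsubmx N).

Definition graph_iso (N1 N2 : nat) (A1 : 'M[int]_N1) (A2 : 'M[int]_N2)
    (f : 'I_N1 -> 'I_N2) : Prop :=
  bijective f /\ forall x y, adjacency A2 (f x) (f y) = adjacency A1 x y.

Definition first_part (a b : nat) : {set 'I_(a + b)} :=
  [set lshift b i | i : 'I_a].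

Definition last_part (a b : nat) : {set 'I_(a + b)} :=
  [set rshift a j | j : 'I_b].

Definition respects_parts (a1 b1 a2 b2 : nat)
    (f : 'I_(a1 + b1) -> 'I_(a2 + b2)) : Prop :=
  (f @: first_part a1 b1 = first_part a2 b2 /\
   f @: last_part a1 b1 = last_part a2 b2) \/
  (f @: first_part a1 b1 = last_part a2 b2 /\
   f @: last_part a1 b1 = first_part a2 b2).

Definition PET (n : nat) (M : 'M[int]_n) : Prop :=
  exists P Q : 'M[int]_n,
    [/\ is_perm_mx P, is_perm_mx Q & P *m M *m Q = M^T].

(* PET only applies to square matrices, so a rectangular biadjacency matrix    *)
(* must first be shown to be square.                                           *)
Definition property_pi (m n : nat) (M : 'M[int]_(m, n)) : Prop :=
  exists e : m = n, PET (castmx (e, erefl n) M).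

Lemma adjacency_sym (N : nat) (A : 'M[int]_N) :
  A^T = A -> symmetric (adjacency A).
Proof. by move=> sA x y; rewrite /adjacency -{1}sA mxE. Qed.

Lemma adjacency_irr (N : nat) (A : 'M[int]_N) :
  (forall i, A i i = 0) -> irreflexive (adjacency A).
Proof. by move=> dA x; rewrite /adjacency dA. Qed.

Lemma ptens_bip (m n p q : nat) (V : 'M[int]_(m, n)) (B : 'M[int]_(p, q)) :
  ptensmx (bip_mx V) (bip_mx B) = block_mx 0 (V *t B) (V^T *t B^T) 0.
Proof.
rewrite /ptensmx /bip_mx !block_mxKul !block_mxKur !block_mxKdl !block_mxKdr.
by congr block_mx; apply/matrixP => i j; rewrite !mxE mul0r.
Qed.

Lemma ptens_bip_sharp (m n p q : nat)
    (V : 'M[int]_(m, n)) (B : 'M[int]_(p, q)) :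
  ptensmx (bip_mx V) (bip_sharp_mx B) = block_mx 0 (V *t B^T) (V^T *t B) 0.
Proof.
rewrite /ptensmx /bip_mx /bip_sharp_mx.
rewrite !block_mxKul !block_mxKur !block_mxKdl !block_mxKdr.
by congr block_mx; apply/matrixP => i j; rewrite !mxE mul0r.
Qed.

(* Main.v *)
Require Import Defs.
From mathcomp Require Import all_boot all_order all_algebra all_fingroup.

(** A (0,1)-matrix is a two-sorted structure (rows, columns, one relation), and
    the Kronecker product is the categorical product of such structures.  The
    isomorphisms in (a) therefore amount to [V (x) B ~ V (x) B^T] or
    [V (x) B ~ V^T (x) B], and the claim is a cancellation law, proved by
    Lovasz's homomorphism counting: the number of assignments satisfying a
    conjunction of atoms (edges and equalities) is multiplicative, and it is
    positive for a structure [a] with an edge, because constant assignments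
    satisfy every atom.  So if [a x r ~ a x r'], these numbers agree for [r] and
    [r'], hence by inclusion-exclusion so do the counts with negated atoms
    allowed.  Taking the full diagram of [r] gives an embedding of [r] in [r'];
    embeddings in both directions force an isomorphism. *)

Set Implicit Arguments.
Unset Strict Implicit.
Unset Printing Implicit Defensive.

Local Open Scope ring_scope.

(** * Two-sorted relations, their isomorphisms and products *)

Definition birel (X Y : Type) := X -> Y -> bool.

Definition birel_iso (X Y X' Y' : Type) (r : birel X Y) (r' : birel X' Y') :=
  exists f : X -> X', exists g : Y -> Y',
    [/\ bijective f, bijective g & forall x y, r' (f x) (g y) = r x y].

Definition birel_prod (X Y X' Y' : Type) (r : birel X Y) (r' : birel X' Y') :
    birel (X * X') (Y * Y') :=
  fun x y => r x.1 y.1 && r' x.2 y.2.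

Lemma birel_iso_sym (X Y X' Y' : Type) (r : birel X Y) (r' : birel X' Y') :
  birel_iso r r' -> birel_iso r' r.
Proof.
move=> [f [g [[f' fK f'K] [g' gK g'K] rfg]]]; exists f', g'; split.
- by exists f.
- by exists g.
- by move=> x y; rewrite -rfg f'K g'K.
Qed.

Lemma birel_iso_trans (X Y X' Y' X'' Y'' : Type)
    (r : birel X Y) (r' : birel X' Y') (r'' : birel X'' Y'') :
  birel_iso r r' -> birel_iso r' r'' -> birel_iso r r''.
Proof.
move=> [f [g [fb gb rfg]]] [f' [g' [fb' gb' rfg']]].
exists (f' \o f), (g' \o g); split; [exact: bij_comp|exact: bij_comp|].
by move=> x y; rewrite /= rfg'.
Qed.

Lemma birel_prodC (X Y X' Y' : Type) (r : birel X Y) (r' : birel X' Y') :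
  birel_iso (birel_prod r r') (birel_prod r' r).
Proof.
exists (fun x => (x.2, x.1)), (fun y => (y.2, y.1)); split.
- by exists (fun x => (x.2, x.1)) => -[].
- by exists (fun y => (y.2, y.1)) => -[].
- by move=> x y; rewrite /birel_prod andbC.
Qed.

Lemma birel_iso_prod (X Y X' Y' Z W : Type)
    (a : birel Z W) (r : birel X Y) (r' : birel X' Y') :
  birel_iso r r' -> birel_iso (birel_prod a r) (birel_prod a r').
Proof.
move=> [f [g [[f' fK f'K] [g' gK g'K] rfg]]].
exists (fun x => (x.1, f x.2)), (fun y => (y.1, g y.2)); split.
- by exists (fun x => (x.1, f' x.2)) => -[u v] /=; rewrite ?fK ?f'K.
- by exists (fun y => (y.1, g' y.2)) => -[u v] /=; rewrite ?gK ?g'K.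
- by move=> x y; rewrite /birel_prod /= rfg.
Qed.

(** * Counting assignments that satisfy a list of literals *)

Section HomCounting.

Variables I J : finType.

(** Equality atoms are present so that their negations can express injectivity. *)
Inductive atom := Edge of I & J | EqL of I & I | EqR of J & J.

Definition assignment (X Y : finType) := ({ffun I -> X} * {ffun J -> Y})%type.

Definition sat (X Y : finType) (r : birel X Y) (h : assignment X Y) (t : atom) :=
  match t with
  | Edge i j => r (h.1 i) (h.2 j)
  | EqL i i' => h.1 i == h.1 i'
  | EqR j j' => h.2 j == h.2 j'
  end.

Definition models (X Y : finType) (r : birel X Y) (P N : seq atom) :=
  [set h : assignment X Y | all (sat r h) P && all (predC (sat r h)) N].

(** The inclusion-exclusion step: it trades one negated atom for a difference of two counts with
    fewer negated atoms. *)
Lemma card_models_cons (X Y : finType) (r : birel X Y) P N t :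
  (#|models r P (t :: N)| + #|models r (t :: P) N| = #|models r P N|)%N.
Proof.
rewrite -[RHS](cardsID [set h | sat r h t]) addnC.
congr (_ + _)%N; apply: eq_card => h; rewrite !inE /=.
  by rewrite [RHS]andbC !andbA.
by rewrite andbCA.
Qed.

(** Assignments into a product are pairs of assignments, and an atom holds in the product exactly
    when it holds in both factors. A negated atom does not split this way, hence the empty negative
    list. *)
Lemma card_models_prod (X Y X' Y' : finType) (a : birel X Y) (r : birel X' Y') P :
  #|models (birel_prod a r) P [::]|
  = (#|models a P [::]| * #|models r P [::]|)%N.
Proof.
pose split_hom (h : assignment (X * X')%type (Y * Y')%type) :=
  (([ffun i => (h.1 i).1], [ffun j => (h.2 j).1]) : assignment X Y,
   ([ffun i => (h.1 i).2], [ffun j => (h.2 j).2]) : assignment X' Y').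
pose pair_hom (k : assignment X Y * assignment X' Y') :
    assignment (X * X')%type (Y * Y')%type :=
  ([ffun i => (k.1.1 i, k.2.1 i)], [ffun j => (k.1.2 j, k.2.2 j)]).
have split_bij : bijective split_hom.
  exists pair_hom.
    by move=> [f g]; congr (_, _); apply/ffunP => i; rewrite !ffunE /= -surjective_pairing.
  by move=> [[f g] [f' g']]; congr (_, _); congr (_, _); apply/ffunP => i; rewrite !ffunE.
rewrite -cardsX -(on_card_preimset (onW_bij _ split_bij)).
apply: eq_card => h; rewrite !inE !andbT -all_predI.
by apply: eq_all => -[i j|i i'|j j'] /=; rewrite !ffunE.
Qed.

Lemma card_models_iso (X Y X' Y' : finType) (r : birel X Y) (r' : birel X' Y') P N :
  birel_iso r r' -> #|models r P N| = #|models r' P N|.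
Proof.
move=> [f [g [[f' fK f'K] [g' gK g'K] rfg]]].
pose push (h : assignment X Y) : assignment X' Y' :=
  ([ffun i => f (h.1 i)], [ffun j => g (h.2 j)]).
have push_bij : bijective push.
  pose pull (h : assignment X' Y') : assignment X Y :=
    ([ffun i => f' (h.1 i)], [ffun j => g' (h.2 j)]).
  exists pull.
    by move=> [u v]; congr (_, _); apply/ffunP => i; rewrite !ffunE /= ?fK ?gK.
  by move=> [u v]; congr (_, _); apply/ffunP => i; rewrite !ffunE /= ?f'K ?g'K.
rewrite -(on_card_preimset (onW_bij _ push_bij)).
have sat_push h : sat r' (push h) =1 sat r h.
  case=> [i j|i i'|j j'] /=; rewrite !ffunE ?rfg //.
    by rewrite (can_eq fK).
  by rewrite (can_eq gK).
apply: eq_card => h; rewrite !inE (eq_all (sat_push h)).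
by congr (_ && _); apply: eq_all => t; rewrite /= sat_push.
Qed.

Lemma models_gt0 (X Y : finType) (a : birel X Y) x y P :
  a x y -> (0 < #|models a P [::]|)%N.
Proof.
move=> axy; apply/card_gt0P; exists ([ffun=> x], [ffun=> y]).
by rewrite inE andbT; apply: allT => -[i j|i i'|j j'] /=; rewrite !ffunE ?eqxx.
Qed.

Lemma card_models_cancel (X Y X' Y' Z W : finType)
    (a : birel Z W) (r : birel X Y) (r' : birel X' Y') z w P N :
  a z w -> birel_iso (birel_prod a r) (birel_prod a r') ->
  #|models r P N| = #|models r' P N|.
Proof.
(* [P] stays general because the induction moves [t] from the negative list to the positive one. In
   the base case the positive factor contributed by [a] is cancelled. *)
move=> azw iso_ar; elim: N P => [|t N IH] P.
  apply/eqP; rewrite -(eqn_pmul2l (models_gt0 P azw)) -!card_models_prod.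
  by rewrite (card_models_iso _ _ iso_ar).
by apply/eqP; rewrite -(eqn_add2r #|models r (t :: P) N|) {2}IH !card_models_cons IH.
Qed.

End HomCounting.

(** * From equal counts to embeddings and cancellation *)

Lemma all_map_enumP (T : finType) (S : Type) (f : T -> S) (a : pred S) (b : pred T) :
  reflect (forall x, b x -> a (f x)) (all a [seq f x | x <- enum T & b x]).
Proof.
rewrite all_map; apply: (iffP allP) => [ab x bx|ab x].
  by apply: ab; rewrite mem_filter bx mem_enum.
by rewrite mem_filter => /andP[/ab].
Qed.

Lemma birel_prod_embed (X Y X' Y' Z W : finType)
    (a : birel Z W) (r : birel X Y) (r' : birel X' Y') z w :
  a z w -> birel_iso (birel_prod a r) (birel_prod a r') ->
  exists f : X -> X', exists g : Y -> Y',
    [/\ injective f, injective g & forall x y, r' (f x) (g y) = r x y].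
Proof.
move=> azw iso_ar.
(* [E] and [D] form the diagram of [r]: its models in any structure are exactly the embeddings of
   [r]. The identity is one in [r], so the equality of counts provides one in [r']. *)
pose E := [seq Edge u.1 u.2 | u <- enum {: X * Y} & r u.1 u.2].
pose D := [seq Edge u.1 u.2 | u <- enum {: X * Y} & ~~ r u.1 u.2]
  ++ [seq EqL Y u.1 u.2 | u <- enum {: X * X} & u.1 != u.2]
  ++ [seq EqR X u.1 u.2 | u <- enum {: Y * Y} & u.1 != u.2].
have: (0 < #|models r E D|)%N.
  apply/card_gt0P; exists (finfun id, finfun id); rewrite inE !all_cat.
  by apply/and4P; split; apply/all_map_enumP => u /=; rewrite !ffunE.
rewrite (card_models_cancel E D azw iso_ar) => /card_gt0P[[f g]].
rewrite inE !all_cat => /and4P[/all_map_enumP edge /all_map_enumP nedge].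
move=> /all_map_enumP neqL /all_map_enumP neqR.
exists f, g; split.
- by move=> x x' /eqP; apply: contraTeq => /(neqL (x, x')).
- by move=> y y' /eqP; apply: contraTeq => /(neqR (y, y')).
- move=> x y; case rxy: (r x y); first exact: edge (x, y) rxy.
  by apply/negbTE/(nedge (x, y)); rewrite rxy.
Qed.

(** Injections in both directions between finite sets equate the cardinalities, so the embedding of
    [r] in [r'] is bijective on both sorts. *)
Lemma birel_prod_cancel (X Y X' Y' Z W : finType)
    (a : birel Z W) (r : birel X Y) (r' : birel X' Y') z w :
  a z w -> birel_iso (birel_prod a r) (birel_prod a r') -> birel_iso r r'.
Proof.
move=> azw iso_ar.
have [f [g [f_inj g_inj rfg]]] := birel_prod_embed azw iso_ar.
have [f' [g' [f'_inj g'_inj _]]] := birel_prod_embed azw (birel_iso_sym iso_ar).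
exists f, g; split => //.
  exact: inj_card_bij f_inj (leq_card f' f'_inj).
exact: inj_card_bij g_inj (leq_card g' g'_inj).
Qed.

(** * Zero-one matrices and bipartite graphs as relations *)

Definition mx_birel (m n : nat) (M : 'M[int]_(m, n)) : birel 'I_m 'I_n :=
  fun i j => M i j == 1.

(** For entries in {0, 1}, a product is 1 exactly when both factors are; over the integers (-1)(-1)
    = 1 would break this. *)
Lemma mx_birel_tens (m n p q : nat) (V : 'M[int]_(m, n)) (B : 'M[int]_(p, q)) :
  zero_one V -> zero_one B ->
  birel_iso (birel_prod (mx_birel V) (mx_birel B)) (mx_birel (V *t B)).
Proof.
move=> V01 B01; exists (@mxtens_index m p), (@mxtens_index n q); split.
- exact: Bijective (@mxtens_indexK _ _) (@mxtens_unindexK _ _).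
- exact: Bijective (@mxtens_indexK _ _) (@mxtens_unindexK _ _).
move=> [i k] [j l]; rewrite /mx_birel /birel_prod tensmxE /=.
by case: (V01 i j) => ->; case: (B01 k l) => ->.
Qed.

Lemma zero_one_tr (m n : nat) (M : 'M[int]_(m, n)) : zero_one M -> zero_one M^T.
Proof. by move=> M01 i j; rewrite mxE. Qed.

Lemma zero_one_birel_inj (m n : nat) (M N : 'M[int]_(m, n)) :
  zero_one M -> zero_one N -> (forall i j, mx_birel M i j = mx_birel N i j) ->
  M = N.
Proof.
move=> M01 N01 eqMN; apply/matrixP => i j.
by have := eqMN i j; rewrite /mx_birel; case: (M01 i j) => ->; case: (N01 i j) => ->.
Qed.

Lemma perm_mx_equivE (n : nat) (s t : 'S_n) (M : 'M[int]_n) i j :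
  (perm_mx s *m M *m perm_mx t) i j = M (s i) ((t^-1)%g j).
Proof.
rewrite -row_permE (_ : t = ((t^-1)^-1)%g); last by rewrite invgK.
by rewrite -col_permE !mxE invgK.
Qed.

Lemma property_piP (m n : nat) (M : 'M[int]_(m, n)) :
  zero_one M -> property_pi M <-> birel_iso (mx_birel M) (mx_birel M^T).
Proof.
move=> M01; split.
  move=> [e]; case: _ / e M M01 => M M01 [_ [_ [/is_perm_mxP[s ->] /is_perm_mxP[t ->]]]].
  rewrite castmx_id => eqM.
  (* The hypothesis reads [M (s i) (t^-1 j) = M^T i j]; substituting [s^-1 i] and [t j] gives the
     required pair. *)
  exists (s^-1)%g, t; split; [exact/injF_bij/perm_inj|exact/injF_bij/perm_inj|].
  by move=> i j; rewrite /mx_birel -eqM perm_mx_equivE permKV permK.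
move=> [f [g [fb gb Mfg]]].
(* [f] maps the rows of [M] bijectively to those of [M^T], which forces squareness. *)
have emn : m = n by rewrite -[m]card_ord -[n]card_ord; apply: bij_eq_card fb.
subst n; exists (erefl m); rewrite castmx_id.
pose s := perm (bij_inj fb); pose t := perm (bij_inj gb).
have Mst i j : mx_birel M^T (s i) (t j) = mx_birel M i j by rewrite !permE.
exists (perm_mx s^-1), (perm_mx t); split; [exact: perm_mx_is_perm|exact: perm_mx_is_perm|].
apply: zero_one_birel_inj => [i j||i j]; first by rewrite perm_mx_equivE.
  exact: zero_one_tr.
rewrite -[i in RHS](permKV s) -[j in RHS](permKV t) Mst.
by rewrite /mx_birel perm_mx_equivE.
Qed.

(** An isomorphism that keeps the parts is a pair of bijections on rows and on columns; one that
    exchanges them matches rows of [M] with columns of [N], whence [N^T]. *)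
Lemma block_bip_iso (a b c d : nat) (M : 'M[int]_(a, b)) (N : 'M[int]_(c, d)) :
  (exists f : 'I_(a + b) -> 'I_(c + d),
     graph_iso (block_mx 0 M M^T 0) (block_mx 0 N N^T 0) f /\ respects_parts f)
  <-> birel_iso (mx_birel M) (mx_birel N) \/ birel_iso (mx_birel M) (mx_birel N^T).
Proof.
split.
  move=> [f [[fb adjf]]].
  have f_inj := bij_inj fb.
  (* One restriction argument serves all four pairings of first and last parts, with [s] and [t] as
     the part inclusions. *)
  have bij_restr (k l : nat) (s : 'I_k -> 'I_(a + b)) (t : 'I_l -> 'I_(c + d)) :
      injective s -> injective t -> f @: [set s i | i : 'I_k] = [set t i | i : 'I_l] ->
      exists2 g : 'I_k -> 'I_l, bijective g & forall i, f (s i) = t (g i).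
    move=> s_inj t_inj eq_im.
    have /fin_all_exists[g fg] (i : 'I_k) : exists j, f (s i) = t j.
      have: f (s i) \in f @: [set s i | i : 'I_k] by rewrite !imset_f.
      by rewrite eq_im => /imsetP[j _ ->]; exists j.
    exists g => //; apply: inj_card_bij.
      by move=> i j eq_g; apply/s_inj/f_inj; rewrite !fg eq_g.
    rewrite -(card_imset predT t_inj) -(card_imset predT s_inj).
    by rewrite -eq_im card_imset.
  have [lI rI] := (@lshift_inj, @rshift_inj).
  case=> -[eqF eqL].
    have [g1 g1b fg1] := bij_restr _ _ _ _ (lI _ _) (lI _ _) eqF.
    have [g2 g2b fg2] := bij_restr _ _ _ _ (rI _ _) (rI _ _) eqL.
    left; exists g1, g2; split=> // x y.
    have := adjf (lshift b x) (rshift a y).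
    by rewrite fg1 fg2 /adjacency !block_mxEur.
  have [g1 g1b fg1] := bij_restr _ _ _ _ (lI _ _) (rI _ _) eqF.
  have [g2 g2b fg2] := bij_restr _ _ _ _ (rI _ _) (lI _ _) eqL.
  right; exists g1, g2; split=> // x y.
  have := adjf (lshift b x) (rshift a y).
  by rewrite fg1 fg2 /adjacency block_mxEur block_mxEdl.
have im_part (k l : nat) (s : 'I_k -> 'I_(a + b)) (t : 'I_l -> 'I_(c + d)) f
    (g : 'I_k -> 'I_l) : bijective g -> (forall i, f (s i) = t (g i)) ->
    f @: [set s i | i : 'I_k] = [set t i | i : 'I_l].
  move=> [g' gK g'K] fs; rewrite -imset_comp; apply/setP => x.
  apply/imsetP/imsetP => -[i _ ->]; first by exists (g i); rewrite /= ?fs.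
  by exists (g' i); rewrite //= fs g'K.
(* Conversely, the vertex map is glued on disjoint sums and carried to ordinals by [split] and
   [unsplit]. *)
have sum_bij (k l : nat) (f : 'I_a -> 'I_k) (g : 'I_b -> 'I_l) :
    bijective f -> bijective g ->
    exists2 h : 'I_a + 'I_b -> 'I_k + 'I_l, bijective h &
      (forall i, h (inl i) = inl (f i)) /\ (forall j, h (inr j) = inr (g j)).
  move=> [f' fK f'K] [g' gK g'K].
  exists (fun u => match u with inl i => inl (f i) | inr j => inr (g j) end) => //.
  exists (fun u => match u with inl i => inl (f' i) | inr j => inr (g' j) end);
    by case=> i; rewrite ?fK ?gK ?f'K ?g'K.
have split_bij (k l : nat) : bijective (@split k l).
  exact: Bijective (@splitK _ _) (@unsplitK _ _).
have unsplit_bij (k l : nat) : bijective (@unsplit k l).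
  exact: Bijective (@unsplitK _ _) (@splitK _ _).
case=> -[f [g [fb gb rfg]]].
  have [h hb [hl hr]] := sum_bij _ _ _ _ fb gb.
  pose F x : 'I_(c + d) := unsplit (h (split x)).
  have Fl i : F (lshift b i) = lshift d (f i) by rewrite /F (unsplitK (inl i)) hl.
  have Fr j : F (rshift a j) = rshift c (g j) by rewrite /F (unsplitK (inr j)) hr.
  exists F; split; last by left; split; [exact: im_part fb Fl|exact: im_part gb Fr].
  split; first exact: bij_comp (unsplit_bij _ _) (bij_comp hb (split_bij _ _)).
  move=> x y; rewrite /adjacency.
  case: (split_ordP x) => i ->; case: (split_ordP y) => j ->; rewrite ?Fl ?Fr.
  - by rewrite !block_mxEul !mxE.
  - by rewrite !block_mxEur; apply: rfg.
  - by rewrite !block_mxEdl !mxE; apply: rfg.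
  - by rewrite !block_mxEdr !mxE.
(* Here [f] lands in the columns of [N] and [g] in its rows, so the summands must be exchanged
   before [unsplit]. *)
pose swap (u : 'I_d + 'I_c) : 'I_c + 'I_d :=
  match u with inl i => inr i | inr j => inl j end.
have swap_bij : bijective swap.
  by exists (fun u => match u with inl i => inr i | inr j => inl j end); case.
have [h hb [hl hr]] := sum_bij _ _ _ _ fb gb.
pose F x : 'I_(c + d) := unsplit (swap (h (split x))).
have Fl i : F (lshift b i) = rshift c (f i) by rewrite /F (unsplitK (inl i)) hl.
have Fr j : F (rshift a j) = lshift d (g j) by rewrite /F (unsplitK (inr j)) hr.
exists F; split; last by right; split; [exact: im_part fb Fl|exact: im_part gb Fr].
split.
  exact: bij_comp (unsplit_bij _ _) (bij_comp swap_bij (bij_comp hb (split_bij _ _))).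
move=> x y; rewrite /adjacency.
case: (split_ordP x) => i ->; case: (split_ordP y) => j ->; rewrite ?Fl ?Fr.
- by rewrite block_mxEdr block_mxEul !mxE.
- by rewrite block_mxEdl block_mxEur; apply: rfg.
- by rewrite block_mxEur block_mxEdl [in RHS]mxE -[RHS]rfg /mx_birel mxE.
- by rewrite block_mxEul block_mxEdr !mxE.
Qed.

(** Without an edge every vertex would be isolated, so there is no vertex and [M] is the 0 by 0
    matrix, which is PET. *)
Lemma no_isolated_edge (m n : nat) (M : 'M[int]_(m, n)) :
  zero_one M -> no_isolated (bip_mx M) ->
  property_pi M \/ exists i j, mx_birel M i j.
Proof.
move=> M01 niM.
have [[x y]/= Mxy|noedge] := pickP (fun u => mx_birel M u.1 u.2).
  by right; exists x, y.
have no_vertex (x : 'I_(m + n)) : False.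
  have [y] := niM x; rewrite /adjacency /bip_mx.
  case: (split_ordP x) => i ->; case: (split_ordP y) => j ->.
  - by rewrite block_mxEul mxE.
  - by rewrite block_mxEur => Mij; have := noedge (i, j); rewrite /= /mx_birel Mij.
  - by rewrite block_mxEdl mxE => Mij; have := noedge (j, i); rewrite /= /mx_birel Mij.
  - by rewrite block_mxEdr mxE.
left; apply/property_piP => //.
case: m n M {M01 niM noedge} no_vertex => [|m] [|n] M no_vertex; try by case: (no_vertex ord0).
by exists id, id; split; [exists id|exists id|case].
Qed.

Theorem theorem4p1 (m n p q : nat)
    (V : 'M[int]_(m, n)) (B : 'M[int]_(p, q))
    (V01 : zero_one V) (B01 : zero_one B)
    (GL_no_isolated : no_isolated (bip_mx V))
    (GH_no_isolated : no_isolated (bip_mx B)) :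
  (exists f : 'I_(m * p + n * q) -> 'I_(m * q + n * p),
     graph_iso (ptensmx (bip_mx V) (bip_mx B))
               (ptensmx (bip_mx V) (bip_sharp_mx B)) f
     /\ respects_parts f)
  <-> property_pi V \/ property_pi B.
Proof.
(* Each lower left block is rewritten as the transpose of the upper right one, so that
   [block_bip_iso] applies; its second alternative becomes [V *t B] against [V^T *t B]. *)
rewrite ptens_bip ptens_bip_sharp -trmx_tens -[B in V^T *t B]trmxK -trmx_tens.
apply: (iff_trans (block_bip_iso _ _)); rewrite trmx_tens trmxK.
have Vt01 := zero_one_tr V01; have Bt01 := zero_one_tr B01.
have VB := mx_birel_tens V01 B01.
have VBt := mx_birel_tens V01 Bt01.
have VtB := mx_birel_tens Vt01 B01.
split.
  have [|[i [j Vij]]] := no_isolated_edge V01 GL_no_isolated; first by left.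
  have [|[k [l Bkl]]] := no_isolated_edge B01 GH_no_isolated; first by right.
  (* A part-preserving isomorphism lets [V] be cancelled, leaving [B] and [B^T]; a part-exchanging
     one lets [B] be cancelled, leaving [V] and [V^T]. *)
  case=> isoM; [right; apply/(property_piP B01)|left; apply/(property_piP V01)].
    apply: birel_prod_cancel Vij _.
    exact: birel_iso_trans VB (birel_iso_trans isoM (birel_iso_sym VBt)).
  apply: birel_prod_cancel Bkl _.
  apply: birel_iso_trans (birel_prodC _ _) _.
  apply: birel_iso_trans _ (birel_prodC _ _).
  exact: birel_iso_trans VB (birel_iso_trans isoM (birel_iso_sym VtB)).
(* If [V] is PET, the parts get exchanged; if [B] is PET, they are kept. *)
case=> [/(property_piP V01) isoV|/(property_piP B01) isoB]; [right|left].
  apply: birel_iso_trans (birel_iso_sym VB) (birel_iso_trans _ VtB).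
  apply: birel_iso_trans (birel_prodC _ _) _.
  apply: birel_iso_trans _ (birel_prodC _ _).
  exact: birel_iso_prod.
apply: birel_iso_trans (birel_iso_sym VB) (birel_iso_trans _ VBt).
exact: birel_iso_prod.
Qed.
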